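(* Let $N\geq 1$ and let $T:\mathbb{R}^N\to\mathbb{R}^N$ be a firmly nonexpansive operator such that $\operatorname{dom}T=\mathbb{R}^N$. Then, for every real $\lambda\geq 0$, the operator $$T_{\lambda}=\left(\lambda T^{-1}+(1-\lambda)\operatorname{Id}\right)^{-1}$$ is firmly nonexpansive and $\operatorname{dom}T_{\lambda}=\mathbb{R}^N$.
   Context: Operators are set-valued maps $A:\mathbb{R}^N\to 2^{\mathbb{R}^N}$, with $\operatorname{dom}A=\{\boldsymbol{x} : A\boldsymbol{x}\neq\emptyset\}$ and graph $\operatorname{gra}A=\{(\boldsymbol{x},\boldsymbol{u}) : \boldsymbol{u}\in A\boldsymbol{x}\}$; single-valued maps are regarded as a special case. The inverse is $A^{-1}\boldsymbol{u}=\{\boldsymbol{x} : \boldsymbol{u}\in A\boldsymbol{x}\}$, and $\operatorname{Id}$ is the identity operator. $A$ is firmly nonexpansive if $\langle\boldsymbol{x}-\boldsymbol{y},\boldsymbol{u}-\boldsymbol{v}\rangle\geq\|\boldsymbol{u}-\boldsymbol{v}\|_2^2$ for all $(\boldsymbol{x},\boldsymbol{u}),(\boldsymbol{y},\boldsymbol{v})\in\operatorname{gra}A$, with the Euclidean scalar product and norm (in particular such an $A$ is single-valued on its domain). Sums and scalar multiples of operators are pointwise: $(\lambda A+(1-\lambda)\operatorname{Id})\boldsymbol{x}=\{\lambda\boldsymbol{a}+(1-\lambda)\boldsymbol{x} : \boldsymbol{a}\in A\boldsymbol{x}\}$ for $\lambda>0$. For $\lambda=0$, the convention is that $0\cdot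 A$ is the zero operator defined on all of $\mathbb{R}^N$, so $T_0=\operatorname{Id}$. *)

(* Defs.v *)
From mathcomp Require Import all_boot all_order all_algebra.
From mathcomp Require Import classical_sets reals.

Set Implicit Arguments.
Unset Strict Implicit.
Unset Printing Implicit Defensive.

Import Order.TTheory GRing.Theory Num.Theory.

Local Open Scope classical_set_scope.
Local Open Scope ring_scope.

(* The norm MathComp-Analysis puts on 'rV[R]_N is the max norm, hence the
   explicit Euclidean scalar product and norm. *)
Definition dotp (R : realType) (N : nat) (x y : 'rV[R]_N) : R :=
  \sum_(i < N) x 0 i * y 0 i.

Definition norm2 (R : realType) (N : nat) (x : 'rV[R]_N) : R :=
  Num.sqrt (dotp x x).

Definition operator (R : realType) (N : nat) : Type :=
  'rV[R]_N -> set 'rV[R]_N.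

Definition op_dom (R : realType) (N : nat) (A : operator R N) :
  set 'rV[R]_N := [set x | A x !=set0].

Definition op_gra (R : realType) (N : nat) (A : operator R N) :
  set ('rV[R]_N * 'rV[R]_N) := [set p | A p.1 p.2].

Definition op_inv (R : realType) (N : nat) (A : operator R N) :
  operator R N := fun u => [set x | A x u].

Definition op_id (R : realType) (N : nat) : operator R N :=
  fun x => [set x].

Definition op_add (R : realType) (N : nat) (A B : operator R N) :
  operator R N := fun x => [set a + b | a in A x & b in B x].

(* 0 . A is the zero operator on the whole space, including the points where
   A is empty; the pointwise image alone would be empty there. *)
Definition op_scale (R : realType) (N : nat) (lambda : R) (A : operator R N) :
  operator R N :=
  fun x => if lambda == 0 then [set 0] else [set lambda *: a | a in A x].

Definition firmly_nonexpansive (R : realType) (N : nat) (A : operator R N) :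
  Prop :=
  forall x u y v : 'rV[R]_N, op_gra A (x, u) -> op_gra A (y, v) ->
    dotp (x - y) (u - v) >= norm2 (u - v) ^+ 2.

Definition op_relax (R : realType) (N : nat) (lambda : R) (T : operator R N) :
  operator R N :=
  op_inv (op_add (op_scale lambda (op_inv T))
                 (op_scale (1 - lambda) (@op_id R N))).

(* Main.v *)
(* Firm nonexpansiveness of [T] makes the reflection [2 T - Id] nonexpansive.
   For [lambda > 0], solving [lambda a + (1 - lambda) T a = z] amounts to finding
   a fixed point of [a |-> (2 z - (1 - lambda) (2 T a - a)) / (1 + lambda)], which
   contracts Euclidean distances by the factor [|1 - lambda| / (1 + lambda) < 1];
   then [T a] belongs to [T_lambda z]. *)
Require Import Defs.
From HB Require Import structures.
From mathcomp Require Import all_boot all_order all_algebra.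
From mathcomp Require Import classical_sets reals.
From mathcomp Require Import boolp functions interval_inference topology.
From mathcomp Require Import normedtype sequences ring lra.

Import Order.TTheory GRing.Theory Num.Theory.
Import numFieldNormedType.Exports.
Local Open Scope classical_set_scope.
Local Open Scope ring_scope.

(* The library proves completeness of matrix spaces only as uniform spaces;
   redeclaring it over [R] lets HB join it with the normed module structure. *)
HB.instance Definition _ (R : realType) (m n : nat) :=
  Uniform_isComplete.Build 'M[R]_(m, n) cauchy_cvg.

Section ScalarProduct.
Context {R : realType} {N : nat}.
Implicit Types (x y z : 'rV[R]_N) (a : R).

Lemma dotpC x y : dotp x y = dotp y x.
Proof. by apply: eq_bigr => i _; rewrite mulrC. Qed.

Lemma dotpDl x y z : dotp (x + y) z = dotp x z + dotp y z.
Proof. by rewrite -big_split; apply: eq_bigr => i _; rewrite mxE mulrDl. Qed.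

Lemma dotpZl a x y : dotp (a *: x) y = a * dotp x y.
Proof. by rewrite mulr_sumr; apply: eq_bigr => i _; rewrite mxE mulrA. Qed.

Lemma dotpNl x y : dotp (- x) y = - dotp x y.
Proof. by rewrite -scaleN1r dotpZl mulN1r. Qed.

Lemma dotpDr x y z : dotp x (y + z) = dotp x y + dotp x z.
Proof. by rewrite !(dotpC x) dotpDl. Qed.

Lemma dotpZr a x y : dotp x (a *: y) = a * dotp x y.
Proof. by rewrite !(dotpC x) dotpZl. Qed.

Lemma dotpNr x y : dotp x (- y) = - dotp x y.
Proof. by rewrite !(dotpC x) dotpNl. Qed.

Definition dotpE :=
  (dotpDl, dotpDr, dotpNl, dotpNr, dotpZl, dotpZr).

Lemma dotp_ge0 x : 0 <= dotp x x.
Proof. by apply: sumr_ge0 => i _; rewrite -expr2 sqr_ge0. Qed.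

Lemma norm2_sqr x : norm2 x ^+ 2 = dotp x x.
Proof. by rewrite sqr_sqrtr // dotp_ge0. Qed.

Lemma norm_coord_le x i : `|x 0 i| <= `|x|.
Proof.
rewrite [leRHS]mx_normrE.
exact: (le_bigmax _ (fun ij : 'I_1 * 'I_N => `|x ij.1 ij.2|) (0, i)).
Qed.

Lemma dotp_le_norm x : dotp x x <= N%:R * `|x| ^+ 2.
Proof.
have -> : N%:R * `|x| ^+ 2 = \sum_(i < N) `|x| ^+ 2.
  by rewrite sumr_const card_ord mulr_natl.
apply: ler_sum => i _.
by rewrite -expr2 -real_normK ?num_real // lerXn2r ?nnegrE // norm_coord_le.
Qed.

(** A nonzero max norm is attained at some coordinate, whose square is one of the nonnegative terms
    of [dotp x x]. *)
Lemma norm_le_dotp x : `|x| ^+ 2 <= dotp x x.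
Proof.
have [x0|/mx_norm_neq0 [[i j] /= xE]] := eqVneq (mx_norm x) 0.
  by rewrite [`|x|]x0 expr0n dotp_ge0.
rewrite [`|x|]xE ord1 real_normK ?num_real // /dotp (bigD1 j) //= expr2 lerDl.
by apply: sumr_ge0 => k _; rewrite -expr2 sqr_ge0.
Qed.

(* The norm of the library is the max norm, for which [F] need not be a
   contraction; a high enough iterate of [F] is one. *)
Lemma euclidean_contraction_fixpoint (c : R) (F : 'rV[R]_N -> 'rV[R]_N) :
  0 <= c < 1 ->
  (forall x y, dotp (F x - F y) (F x - F y) <= c * dotp (x - y) (x - y)) ->
  exists p, F p = p.
Proof.
move=> /andP[c0 c1] Fc.
have Fk k x y : dotp (iter k F x - iter k F y) (iter k F x - iter k F y) <=
    c ^+ k * dotp (x - y) (x - y).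
  elim: k => [|k IH]; first by rewrite mul1r.
  by apply: (le_trans (Fc _ _)); rewrite exprS -mulrA ler_wpM2l.
(* The bound 1/4 is the square of the contraction factor 1/2 sought for the iterate; [N.+1] in place
   of [N] keeps the inverse positive when [N] is 0. *)
have e0 : 0 < (4 * N.+1%:R)^-1 :> R by rewrite invr_gt0 mulr_gt0.
have [k ck] : exists k, c ^+ k * N%:R <= 4^-1.
  have := @cvg_expr R c; rewrite ger0_norm // => /(_ c1).
  move=> /cvgrPdist_lt /(_ _ e0) [k _ /(_ k (leqnn k))] /=.
  rewrite sub0r normrN ger0_norm ?exprn_ge0 // => ck; exists k.
  apply: (@le_trans _ _ (c ^+ k * N.+1%:R)).
    by rewrite ler_wpM2l ?exprn_ge0 // ler_nat.
  by rewrite -ler_pdivlMr // -invfM ltW.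
have Gfun : set_fun setT setT (iter k F) by [].
pose G : {fun setT >-> setT} := mkfun Gfun.
have Gctr : is_contraction G.
  exists (2^-1%:nng : {nonneg R}); split => /=; first lra.
  move=> [x y] _ /=.
  (* After squaring, pass from the max norm to [dotp], contract there by [c ^+ k], and return at the
     cost of a factor [N]. *)
  rewrite -(@ler_pXn2r _ 2) ?nnegrE ?mulr_ge0 //.
  apply: (le_trans (norm_le_dotp _)); apply: (le_trans (Fk _ _ _)).
  apply: (@le_trans _ _ (c ^+ k * (N%:R * `|x - y| ^+ 2))).
    by rewrite ler_wpM2l ?exprn_ge0 // dotp_le_norm.
  rewrite mulrA exprMn ler_wpM2r ?exprn_ge0 //; apply: le_trans ck _; lra.
have [p _ pE] := banach_fixed_point Gctr closedT (ex_intro _ 0 I).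
(* Since [F] commutes with its iterate, [F p] is a fixed point of [G] as well, so uniqueness gives
   [F p = p]. *)
exists p; apply: (contraction_fixpoint_unique Gctr) => //.
rewrite -[RHS]/(iter k F (F p)) -iterSr iterS; congr F; exact: pE.
Qed.

End ScalarProduct.

Section Relaxation.
Context {R : realType} {N : nat} (T : operator R N)
  (hT : firmly_nonexpansive T).
Implicit Types (x y z u : 'rV[R]_N) (lambda : R).

Lemma op_relax0 z : op_relax 0 T z = [set z].
Proof.
rewrite /op_relax /op_inv /op_add /op_scale eqxx subr0 oner_eq0.
apply/seteqP; split => u /=.
  by move=> [_ -> [_ [_ -> <-] <-]]; rewrite scale1r add0r.
by move=> ->; exists 0 => //; exists z; [exists z; rewrite ?scale1r|rewrite add0r].
Qed.

Lemma op_relaxP lambda z u : lambda != 0 ->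
  op_relax lambda T z u <->
  exists2 a, T a u & lambda *: a + (1 - lambda) *: u = z.
Proof.
move=> /negPf l0; rewrite /op_relax /op_inv /op_add /op_scale l0 /=.
(* At [lambda = 1] the convention for the scalar 0 gives the singleton of 0, which agrees with
   [0 *: u]. *)
have scale_id b : (if 1 - lambda == 0 then [set 0]
    else [set (1 - lambda) *: a | a in op_id u]) b <-> b = (1 - lambda) *: u.
  case: eqP => [->|_] /=; first by rewrite scale0r.
  by split=> [[_ -> <-]|->] //; exists u.
split=> [[_ [a Ta <-] [b /scale_id -> <-]]|[a Ta <-]]; first by exists a.
exists (lambda *: a); first by exists a.
by exists ((1 - lambda) *: u) => //; exact/scale_id.
Qed.

(** For [lambda > 0], expand the product of [lambda *: (a - b) + (1 - lambda) *: (u - v)] with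
    [u - v]: the first term is at least [lambda] times the square of [u - v], and the second
    supplies exactly the remaining [1 - lambda]. *)
Lemma op_relax_firmly_nonexpansive lambda : 0 <= lambda ->
  firmly_nonexpansive (op_relax lambda T).
Proof.
rewrite le_eqVlt => /predU1P[<-|l0] x u y v; rewrite /op_gra /=.
  by rewrite !op_relax0 => -> ->; rewrite norm2_sqr.
have ln0 := lt0r_neq0 l0.
move=> /(op_relaxP _ _ _ ln0)[a Ta <-] /(op_relaxP _ _ _ ln0)[b Tb <-].
have /(ler_wpM2l (ltW l0)) := hT a u b v Ta Tb; rewrite !norm2_sqr.
have -> : lambda *: a + (1 - lambda) *: u - (lambda *: b + (1 - lambda) *: v)
    = lambda *: (a - b) + (1 - lambda) *: (u - v).
  by rewrite !scalerBr opprD addrACA.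
by rewrite [dotp (_ *: _ + _) _]dotpDl !dotpZl; lra.
Qed.

(** With [d = x - y] and [e = u - v], the left side equals [dotp d d - 4 * (dotp d e - dotp e e)],
    and the bracket is nonnegative. *)
Lemma reflection_nonexpansive x u y v : T x u -> T y v ->
  dotp ((2 *: u - x) - (2 *: v - y)) ((2 *: u - x) - (2 *: v - y)) <=
  dotp (x - y) (x - y).
Proof.
move=> Tx Ty; have := hT x u y v Tx Ty; rewrite norm2_sqr.
have -> : (2 *: u - x) - (2 *: v - y) = 2 *: (u - v) - (x - y).
  by rewrite scalerBr !opprD addrACA.
move: (x - y) (u - v) => d e.
by rewrite !dotpE (dotpC e d); lra.
Qed.

Lemma op_relax_dom lambda : op_dom T = setT -> 0 <= lambda ->
  op_dom (op_relax lambda T) = setT.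
Proof.
move=> Tdom; rewrite le_eqVlt => /predU1P[<-|l0].
  by apply/seteqP; split=> // z _; exists z; rewrite op_relax0.
have /choice [t tP] : forall x, exists u, T x u.
  by move=> x; have : op_dom T x by rewrite Tdom.
apply/seteqP; split=> // z _.
have l1 : 0 < 1 + lambda by lra.
pose q := (1 - lambda) / (1 + lambda).
pose F a := (2 / (1 + lambda)) *: z - q *: (2 *: t a - a).
have [||a Fa] := @euclidean_contraction_fixpoint R N (q ^+ 2) F.
(* The squares of [1 + lambda] and [1 - lambda] differ by [4 * lambda > 0]. *)
- rewrite sqr_ge0 /= expr_div_n ltr_pdivrMr ?exprn_gt0 // mul1r; nra.
- move=> x y.
  have -> : F x - F y = - q *: ((2 *: t x - x) - (2 *: t y - y)).
    rewrite /F; move: (2 *: t x - x) (2 *: t y - y) => r s.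
    by rewrite opprB addrC addrA subrK scaleNr scalerBr opprB.
  rewrite dotpZl dotpZr mulrA mulrNN -expr2 ler_wpM2l ?sqr_ge0 //.
  exact: reflection_nonexpansive.
exists (t a); apply/op_relaxP; first exact: lt0r_neq0.
(* In each coordinate, clearing the denominator of the fixed-point equation and collecting the
   multiples of [a] gives twice the required identity. *)
exists a => //; apply/rowP => i; move/rowP: Fa => /(_ i).
rewrite /F /q !mxE => Fa.
have : (1 + lambda) * a 0 i =
    2 * z 0 i - (1 - lambda) * (2 * t a 0 i - a 0 i).
  by rewrite -[in LHS]Fa; field; rewrite gt_eqF.
lra.
Qed.

End Relaxation.

Theorem theorem6 (R : realType) (N : nat) (hN : (1 <= N)%N)
    (T : operator R N) (hT : firmly_nonexpansive T)
    (hdom : op_dom T = [set: 'rV[R]_N]) :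
  forall lambda : R, 0 <= lambda ->
    firmly_nonexpansive (op_relax lambda T) /\
    op_dom (op_relax lambda T) = [set: 'rV[R]_N].
Proof.
move=> lambda l0; split; first exact: op_relax_firmly_nonexpansive.
exact: op_relax_dom.
Qed.
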